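(* For all integers $d \ge 2$ and $n \ge d^2$, \[f(n,d) = f(n-d+1,d) + f(n-d,d) - f(n-2d+1,d) + f(n-2d+1,d-1).\]
   Context: A partition of a positive integer $n$ is a finite sequence of positive integers $\lambda = (\lambda_1,\ldots,\lambda_j)$ with $\lambda_1 \ge \cdots \ge \lambda_j$ and $\sum_i \lambda_i = n$; the $\lambda_i$ are its parts. For integers $n \ge 1$ and $d \ge 1$, a partition $\lambda$ of $n$ has fixed point $d$ if $\lambda$ has at least $d$ parts and $\lambda_d = d$ (a partition has at most one fixed point). Let $f(n,d)$ denote the number of partitions of $n$ with fixed point $d$. *)

(* Defs.v *)
From HB Require Import structures.
From mathcomp Require Import all_boot all_order all_algebra.
Set Implicit Arguments.
Unset Strict Implicit.
Unset Printing Implicit Defensive.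

Definition is_part (n : nat) (s : seq nat) : bool :=
  [&& all (fun k => 0 < k) s, sorted geq s & sumn s == n].

Record partition_of (n : nat) : predArgType :=
  PartitionOf { parts :> seq nat; partsP : is_part n parts }.

HB.instance Definition _ n := [isSub for @parts n].
HB.instance Definition _ n := [Countable of partition_of n by <:].

Lemma is_part_size n s : is_part n s -> size s <= n.
Proof.
case/and3P=> pos_s _ /eqP <-; elim: s pos_s => //= a s IHs /andP[a_gt0 pos_s].
by rewrite -add1n leq_add ?IHs.
Qed.

Lemma is_part_leq n s k : is_part n s -> k \in s -> k <= n.
Proof.
case/and3P=> _ _ /eqP <-; elim: s => //= a s IHs.
rewrite inE => /orP[/eqP-> | /IHs le_k]; first exact: leq_addr.
by apply: leq_trans le_k (leq_addl _ _).
Qed.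

(* A partition of n has at most n parts, each at most n: this bounded encoding
   gives the finType structure. *)
Definition part_code n (p : partition_of n) : n.-bseq 'I_n.+1 :=
  insub_bseq n [seq inord k | k <- p].
Definition part_decode n (b : n.-bseq 'I_n.+1) : option (partition_of n) :=
  insub [seq val i | i <- b].

Lemma part_codeK n : pcancel (@part_code n) (@part_decode n).
Proof.
move=> p; rewrite /part_decode /part_code /insub_bseq val_insubd size_map.
rewrite (is_part_size (partsP p)) -map_comp map_id_in ?valK // => k kp /=.
by rewrite inordK // ltnS (is_part_leq (partsP p)).
Qed.

HB.instance Definition _ n : isFinite (partition_of n) :=
  PCanIsFinite (@part_codeK n).

(* Parts are numbered from 1 in the mathematics and from 0 in nth. *)
Definition has_fixed_point (d : nat) (s : seq nat) : bool :=
  [&& 0 < d, d <= size s & nth 0 s d.-1 == d].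

Definition f (n d : nat) : nat :=
  #|[set p : partition_of n | has_fixed_point d p]|.

(* Main.v *)
(** Write d = k + 1. A partition with fixed point d reads u, d, v, where u lists
    k parts >= d and v lists parts <= d. Increasing every part of u by 1 maps
    the partitions of n - d + 1 onto those of n with all parts of u above d;
    inserting a part d in front of v maps the partitions of n - d onto those of
    n in which v starts with d; doing both handles n - 2d + 1. In the remaining
    partitions of n, u ends with d and v has no part d: deleting the fixed part
    and lowering the parts of u by 1 gives exactly the partitions of n - 2d + 1
    with fixed point d - 1. The identity is inclusion-exclusion. *)
Require Import Defs.
From mathcomp Require Import all_boot all_order all_algebra.
From mathcomp Require Import zify.
Set Implicit Arguments.
Unset Strict Implicit.
Unset Printing Implicit Defensive.

(** With d = [k.+1], the pair (u, v) leaves out the fixed part, since its value is known. *)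
Definition split_fixed k (s : seq nat) := (take k s, drop k.+1 s).
Definition join_fixed k (w : seq nat * seq nat) := w.1 ++ k.+1 :: w.2.

Definition fixed_shape (k n : nat) (w : seq nat * seq nat) :=
  [&& size w.1 == k, pairwise geq w.1, all (leq k.+1) w.1, pairwise geq w.2,
      all (fun x => 0 < x <= k.+1) w.2 & sumn w.1 + k.+1 + sumn w.2 == n].

Lemma join_fixedK k w : size w.1 = k -> split_fixed k (join_fixed k w) = w.
Proof.
case: w => u v /= <-; rewrite /split_fixed /join_fixed /= take_size_cat //.
by rewrite -cat_rcons drop_size_cat ?size_rcons.
Qed.

Lemma split_fixedK k s :
  has_fixed_point k.+1 s -> join_fixed k (split_fixed k s) = s.
Proof.
case/and3P=> _ lt_ks /eqP /= sk; rewrite /join_fixed /=.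
by rewrite -{1}sk -drop_nth ?cat_take_drop.
Qed.

(** Since [u] stays at or above [k.+1] and [v] at or below it, the order between the two and the
    positivity of [u] are automatic, so the conditions separate. *)
Lemma fixed_shapeE k n w : size w.1 = k ->
  is_part n (join_fixed k w) && has_fixed_point k.+1 (join_fixed k w) =
  fixed_shape k n w.
Proof.
case: w => u v /= szu; rewrite /is_part /has_fixed_point /fixed_shape.
rewrite /join_fixed /= sorted_pairwise; last by move=> x y z /=; lia.
rewrite all_cat pairwise_cat allrel_consr sumn_cat size_cat nth_cat /= szu.
rewrite ltnn subnn !eqxx -ltn_subLR // subnn andbT addnA andbT /=.
have -> : all (fun x => 0 < x <= k.+1) v = all (leq 1) v && all (geq k.+1) v.
  by rewrite -all_predI; apply: eq_all.
have -> : all (geq^~ k.+1) u = all (leq k.+1) u by [].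
have [ku | _] /= := boolP (all (leq k.+1) u); last by rewrite !(andbF, andFb).
have [kv | _] /= := boolP (all (geq k.+1) v); last by rewrite !(andbF, andFb).
have -> : all (leq 1) u.
  by apply: sub_all ku => x; apply: leq_trans.
have -> : allrel geq u v.
  apply/allrelP => x y /(allP ku) kx /(allP kv) /= ky.
  exact: leq_trans ky kx.
by case: (all _ v); rewrite ?andbT ?andbF //= andbA.
Qed.

Definition fixed_set k n (P : pred (seq nat * seq nat)) :=
  [set p : partition_of n | has_fixed_point k.+1 p & P (split_fixed k p)].

Lemma mem_fixed_set k n P (p : partition_of n) :
  p \in fixed_set k n P ->
  [/\ fixed_shape k n (split_fixed k p), P (split_fixed k p)
    & join_fixed k (split_fixed k p) = p].
Proof.
rewrite inE => /andP[fp Pp]; split=> //; last exact: split_fixedK.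
have szk : size (split_fixed k p).1 = k.
  by case/and3P: fp => _ lt_kp _; rewrite size_takel // ltnW.
by rewrite -fixed_shapeE // split_fixedK // fp partsP.
Qed.

(** The left inverse [h] makes [g] injective on the pairs satisfying [P]. *)
Lemma leq_card_fixed k k' n n' (P P' : pred (seq nat * seq nat)) g h :
    (forall w, fixed_shape k n w -> P w ->
       [/\ fixed_shape k' n' (g w), P' (g w) & h (g w) = w]) ->
  #|fixed_set k n P| <= #|fixed_set k' n' P'|.
Proof.
move=> gP; pose G s := join_fixed k' (g (split_fixed k s)).
pose L m (A : {set partition_of m}) := [seq parts p | p <- enum A].
have szL m (A : {set partition_of m}) : size (L m A) = #|A|.
  by rewrite size_map -cardE.
have uniqL m (A : {set partition_of m}) : uniq (L m A).
  by rewrite map_inj_uniq ?enum_uniq //; apply: val_inj.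
have size_g w : fixed_shape k' n' w -> size w.1 = k' by case/andP=> /eqP.
(* Partitions of [n] and of [n'] have different types, so duplicate-free lists of their underlying
   sequences are compared. *)
rewrite -!szL -(size_map G); apply: uniq_leq_size.
  rewrite map_inj_in_uniq // => s t /mapP[p + ->] /mapP[q + ->].
  rewrite !mem_enum => /mem_fixed_set[shp Pp pK] /mem_fixed_set[shq Pq qK].
  have [[/size_g szp _ pg] [/size_g szq _ qg]] := (gP _ shp Pp, gP _ shq Pq).
  move/(congr1 (split_fixed k')); rewrite !join_fixedK // => /(congr1 h).
  by rewrite pg qg -{2}pK -{2}qK => ->.
move=> _ /mapP[_ /mapP[p + ->] ->]; rewrite mem_enum.
case/mem_fixed_set=> /gP shg /shg[{}shg P'g _] _.
have szg := size_g _ shg; move: (shg); rewrite -fixed_shapeE // => /andP[pg fg].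
apply/mapP; exists (PartitionOf pg) => //.
by rewrite mem_enum inE fg /= join_fixedK.
Qed.

Lemma eq_card_fixed k k' n n' (P P' : pred (seq nat * seq nat)) g h :
    (forall w, fixed_shape k n w -> P w ->
       [/\ fixed_shape k' n' (g w), P' (g w) & h (g w) = w]) ->
    (forall w, fixed_shape k' n' w -> P' w ->
       [/\ fixed_shape k n (h w), P (h w) & g (h w) = w]) ->
  #|fixed_set k n P| = #|fixed_set k' n' P'|.
Proof.
move=> gP hP; apply/eqP; rewrite eqn_leq.
by rewrite (leq_card_fixed gP) (leq_card_fixed hP).
Qed.

Lemma f_fixed_set k n : f n k.+1 = #|fixed_set k n predT|.
Proof. by apply: eq_card => p; rewrite !inE andbT. Qed.

Lemma pairwise_map_succ u : pairwise geq (map S u) = pairwise geq u.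
Proof. by rewrite pairwise_map; apply: eq_pairwise. Qed.

Lemma pairwise_map_pred u : pairwise geq u -> pairwise geq (map predn u).
Proof.
by rewrite pairwise_map; apply: sub_pairwise => x y /=; lia.
Qed.

Lemma sumn_map_succ u : sumn (map S u) = sumn u + size u.
Proof. by elim: u => //= x u ->; lia. Qed.

Lemma map_predK u : all (leq 1) u -> map S (map predn u) = u.
Proof. by elim: u => //= -[|x] u IHu //= /IHu ->. Qed.

Definition prefix_above k (w : seq nat * seq nat) := all (leq k.+2) w.1.
(** The default 0 differs from [k.+1], so an empty [v] does not count as a repetition. *)
Definition repeats k (w : seq nat * seq nat) := head 0 w.2 == k.+1.

Definition raise_prefix (w : seq nat * seq nat) := (map S w.1, w.2).
Definition lower_prefix (w : seq nat * seq nat) := (map predn w.1, w.2).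
Definition insert_part k (w : seq nat * seq nat) := (w.1, k.+1 :: w.2).
Definition remove_part (w : seq nat * seq nat) := (w.1, behead w.2).

Lemma raise_prefixK : cancel raise_prefix lower_prefix.
Proof. by case=> u v; rewrite /lower_prefix /= mapK. Qed.

Lemma lower_prefixK k w : prefix_above k w -> raise_prefix (lower_prefix w) = w.
Proof.
case: w => u v hu; rewrite /raise_prefix /= map_predK //.
by apply: sub_all hu => x; apply: leq_trans.
Qed.

Lemma remove_partK k w : repeats k w -> insert_part k (remove_part w) = w.
Proof. by case: w => u [|x v] //= /eqP /= ->. Qed.

(** Raising the [k] parts of [u] adds [k] to the sum and moves their lower bound from [k.+1] to
    [k.+2]. The equality serves both directions of the bijection. *)
Lemma shape_raise k n w :
  fixed_shape k (n + k) (raise_prefix w) && prefix_above k (raise_prefix w) =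
  fixed_shape k n w.
Proof.
case: w => u v; rewrite /fixed_shape /prefix_above /= size_map.
rewrite pairwise_map_succ sumn_map_succ !all_map.
have -> : all (preim S (leq k.+2)) u = all (leq k.+1) u by [].
have [szu | _] //= := eqVneq (size u) k.
have [ku | _] := boolP (all (leq k.+1) u); last by rewrite !andbF.
have -> : all (preim S (leq k.+1)) u by apply: sub_all ku => x /=; lia.
have -> : (sumn u + size u + k.+1 + sumn v == n + k) =
          (sumn u + k.+1 + sumn v == n) by lia.
by rewrite andbT.
Qed.

(** The inserted part is the largest value allowed in [v], so the order is kept. *)
Lemma shape_insert k n w :
  fixed_shape k (n + k.+1) (insert_part k w) = fixed_shape k n w.
Proof.
case: w => u v; rewrite /fixed_shape /=.
have -> : (sumn u + k.+1 + (k.+1 + sumn v) == n + k.+1) =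
          (sumn u + k.+1 + sumn v == n) by lia.
have [kv | _] := boolP (all (fun x => 0 < x <= k.+1) v); last by rewrite !andbF.
have -> : all (geq k.+1) v by apply: sub_all kv => x /andP[].
by rewrite leqnn.
Qed.

Lemma card_prefix_above k n :
  #|fixed_set k (n + k) (prefix_above k)| = #|fixed_set k n predT|.
Proof.
apply: (@eq_card_fixed _ _ _ _ _ _ lower_prefix raise_prefix) => w shw.
  by move=> hw; rewrite -shape_raise (lower_prefixK hw) shw hw.
by rewrite raise_prefixK; move: shw; rewrite -shape_raise => /andP[].
Qed.

Lemma card_repeats k n :
  #|fixed_set k (n + k.+1) (repeats k)| = #|fixed_set k n predT|.
Proof.
apply: (@eq_card_fixed _ _ _ _ _ _ remove_part (insert_part k)) => w shw.
  by move=> rw; rewrite -shape_insert (remove_partK rw).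
by rewrite shape_insert /repeats /=; split=> //; case: w {shw}.
Qed.

(** Insertion in [v] leaves [u] alone, which reduces the count to [card_prefix_above]. *)
Lemma card_prefix_above_repeats k n :
  #|fixed_set k (n + k + k.+1) (predI (prefix_above k) (repeats k))| =
  #|fixed_set k n predT|.
Proof.
rewrite -card_prefix_above.
apply: (@eq_card_fixed _ _ _ _ _ _ remove_part (insert_part k)) => w shw.
  by case/andP=> hw rw; rewrite -shape_insert (remove_partK rw).
move=> hw; rewrite shape_insert; split=> //; last by case: w {shw hw}.
by apply/andP; split; last exact: eqxx.
Qed.

(** The implicit part changes from [j.+1] to [j.+2]. Raising [u] adds [j], and the appended [j.+2]
    brings the total gain to [j + j.+3]. Backwards, [take j] drops the last part of [u], which when
    lowered becomes the new implicit part. *)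
Definition lift_fixed j (w : seq nat * seq nat) :=
  (rcons (map S w.1) j.+2, w.2).
Definition unlift_fixed j (w : seq nat * seq nat) :=
  (map predn (take j w.1), w.2).

Lemma card_low_norep j n :
  #|fixed_set j.+1 (n + j + j.+3)
      (predC (predU (prefix_above j.+1) (repeats j.+1)))| =
  #|fixed_set j n predT|.
Proof.
apply: (@eq_card_fixed _ _ _ _ _ _ (unlift_fixed j) (lift_fixed j)).
  case=> u v /and5P[/= + pu + pv /andP[+ /eqP sum_n]].
  case/lastP: u pu sum_n => [|u x] //=.
  rewrite /prefix_above /repeats /= size_rcons eqSS.
  rewrite pairwise_rcons !all_rcons sumn_rcons => /andP[xu pu] sum_n /eqP szu.
  move=> /andP[jx ju] jv; rewrite negb_or negb_and -ltnNge.
  case/andP=> low norep.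
  (* [x] is the least part of [u] and at least [j.+2]; some part of [u] is below [j.+3], hence so is
     [x]. *)
  have x_j : x = j.+2.
    apply/eqP; rewrite eqn_leq jx andbT; case/orP: low => [|/allPn[y yu]].
      by lia.
    by have := allP xu y yu; rewrite /=; lia.
  have ju1 : all (leq 1) u by apply: sub_all ju => y; apply: leq_trans.
  have take_u : take j (rcons u x) = u by rewrite -cats1 take_size_cat.
  split=> //; rewrite /lift_fixed /unlift_fixed /= take_u; last first.
    by rewrite map_predK // x_j.
  have sumu : sumn u = sumn (map predn u) + j.
    by rewrite -{1}(map_predK ju1) sumn_map_succ size_map szu.
  apply/and5P; split; rewrite /= ?size_map ?szu ?pairwise_map_pred //.
    by rewrite all_map; apply: sub_all ju => y /=; lia.
  apply/andP; split; last by lia.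
  (* The head of [v] is its largest part and is not [j.+2], so every part is at most [j.+1]. *)
  apply/allP=> y yv; have := allP jv y yv => /andP[y_gt0 y_le].
  suff : y <= head 0 v /\ head 0 v <= j.+2 by lia.
  case: v pv jv yv {norep sum_n} => //= z v /andP[zv _] /andP[/andP[_ ->] _].
  by rewrite inE => /predU1P[-> // | /(allP zv)].
case=> u v /and5P[/= /eqP szu pu ju pv /andP[jv /eqP sum_n]] _.
rewrite /unlift_fixed /lift_fixed /prefix_above /repeats /=; split.
- apply/and5P; split; rewrite /= ?size_rcons ?size_map ?szu //.
  + by rewrite pairwise_rcons pairwise_map_succ pu all_map andbT.
  + by rewrite all_rcons leqnn all_map.
  rewrite sumn_rcons sumn_map_succ szu; apply/andP; split; last by lia.
  by apply: sub_all jv => y; lia.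
- rewrite all_rcons ltnn /=; case: v jv {pv sum_n} => //= z v /andP[+ _].
  by lia.
by rewrite -cats1 take_size_cat ?size_map // mapK.
Qed.

(** Here d = [j.+2] and [m] is n - 2d + 1; moving the negative term to the left keeps the identity
    in the naturals. *)
Lemma fixed_count j m (n := m + j + j.+3) :
  f n j.+2 + f m j.+2 = f (m + j.+2) j.+2 + f (m + j.+1) j.+2 + f m j.+1.
Proof.
have n_rep : n = m + j.+1 + j.+2 by rewrite /n; lia.
have n_high : n = m + j.+2 + j.+1 by rewrite /n; lia.
(* Each term becomes the size of a family of partitions of the same [n]. *)
rewrite !f_fixed_set -(card_prefix_above _ (m + j.+2)).
rewrite -(card_repeats _ (m + j.+1)) -(card_low_norep j m).
rewrite -(card_prefix_above_repeats _ m) -n_rep -n_high -/n.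
pose A P := fixed_set j.+1 n P.
have -> : #|A predT| = #|A (prefix_above j.+1) :|: A (repeats j.+1)| +
                       #|A (predC (predU (prefix_above j.+1) (repeats j.+1)))|.
  rewrite -(cardsID (A (prefix_above j.+1) :|: A (repeats j.+1)) (A predT)).
  by congr (_ + _); apply: eq_card => p; rewrite !inE /=;
     case: (has_fixed_point _ _); case: (prefix_above _ _); case: (repeats _ _).
have -> : #|A (predI (prefix_above j.+1) (repeats j.+1))| =
          #|A (prefix_above j.+1) :&: A (repeats j.+1)|.
  by apply: eq_card => p; rewrite !inE /=; case: (has_fixed_point _ _).
rewrite -/(A (prefix_above j.+1)) -/(A (repeats j.+1)).
have := cardsUI (A (prefix_above j.+1)) (A (repeats j.+1)).
by rewrite -/(A (predC _)); lia.
Qed.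

Local Open Scope ring_scope.

(* The equation is in int, so that - is genuine subtraction; the natural-number
   subtractions in the arguments of f never truncate, since 2 * d <= d ^ 2 <= n. *)
Theorem theorem1p1 (d n : nat) (hd : (2 <= d)%N) (hn : (d ^ 2 <= n)%N) :
  (f n d)%:Z =
    (f (n - d + 1) d)%:Z + (f (n - d) d)%:Z
    - (f (n - 2 * d + 1) d)%:Z + (f (n - 2 * d + 1) (d - 1))%:Z.
Proof.
case: d hd hn => [|[|j]] // _ hn.
have le_n : (2 * j.+2 <= n)%N by apply: leq_trans hn; nia.
have := fixed_count j (n - 2 * j.+2 + 1).
have -> : (n - 2 * j.+2 + 1 + j + j.+3 = n)%N by lia.
have -> : (n - 2 * j.+2 + 1 + j.+2 = n - j.+2 + 1)%N by lia.
have -> : (n - 2 * j.+2 + 1 + j.+1 = n - j.+2)%N by lia.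
by rewrite subn1 /=; lia.
Qed.
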